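(* Let $q\ge 2$ and let $K_{q,q}\setminus\{e\}$ denote the graph obtained from the complete bipartite graph $K_{q,q}$ by deleting one edge $e$. Then $\mathcal{E}_{RD}(K_{q,q}\setminus\{e\})<\mathcal{E}_{RD}(K_{q,q})$ if $2\le q\le 7$, and $\mathcal{E}_{RD}(K_{q,q}\setminus\{e\})>\mathcal{E}_{RD}(K_{q,q})$ if $q\ge 8$.
   Context: For a connected graph $G$ with vertices $v_1,\dots,v_n$, $RD(G)$ is the $n\times n$ matrix with $(i,j)$ entry $1/d(v_i,v_j)$ for $i\ne j$ and $0$ on the diagonal ($d$ the shortest-path distance), and the reciprocal distance energy is $\mathcal{E}_{RD}(G)=\sum_{i=1}^n|\lambda_i(RD(G))|$. *)

(* Defs.v *)
From mathcomp Require Import all_boot all_order all_algebra.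
From mathcomp Require Import complex.

Set Implicit Arguments.
Unset Strict Implicit.
Unset Printing Implicit Defensive.

Import GRing.Theory Num.Theory.
Local Open Scope ring_scope.

Record sgraph := SGraph {
  vertex :> finType;
  edge : rel vertex;
  edge_sym : symmetric edge;
  edge_irrefl : irreflexive edge }.

Definition has_walk (G : sgraph) (k : nat) (x y : G) : bool :=
  [exists p : k.-tuple G, path (@edge G) x p && (last x p == y)].

(* A shortest walk has fewer than #|G| edges; the value #|G| is only taken
   when x and y lie in different components. *)
Definition dist (G : sgraph) (x y : G) : nat :=
  \big[minn/#|G|]_(k < #|G| | has_walk k x y) k.

Lemma dist_min (G : sgraph) (x y : G) (k : nat) :
  (k < #|G|)%N -> has_walk k x y -> (dist x y <= k)%N.
Proof.
move=> kG w; rewrite /dist; have := mem_index_enum (Ordinal kG).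
elim: index_enum => //= i s IH; rewrite big_cons inE => /predU1P[<- /=|/IH le].
  by rewrite w geq_minl.
by case: ifP => // _; rewrite geq_min le orbT.
Qed.

Lemma dist_walk (G : sgraph) (x y : G) :
  connect (@edge G) x y -> has_walk (dist x y) x y.
Proof.
case/connectP => p0 /shortenP[p pth up _] ->.
have kG : (size p < #|G|)%N by have := max_card [in x :: p]; rewrite (card_uniqP up).
have w : has_walk (size p) x (last x p).
  by apply/existsP; exists (in_tuple p); rewrite pth eqxx.
have: has_walk (dist x (last x p)) x (last x p) \/ dist x (last x p) = #|G|.
  rewrite /dist; elim/big_rec: _ => [|k d wk IH]; first by right.
  by rewrite /minn; case: ifP => _; [left | exact: IH].
by case=> // E; have := dist_min kG w; rewrite E leqNgt kG.
Qed.

Definition connected_graph (G : sgraph) : Prop :=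
  forall x y : G, connect (@edge G) x y.

Definition RD (R : rcfType) (G : sgraph) : 'M[R]_#|G| :=
  \matrix_(i, j)
    if i == j then 0 else (dist (enum_val i) (enum_val j))%:R^-1.

Definition eigenvalues (C : closedFieldType) (n : nat) (A : 'M[C]_n) : seq C :=
  sval (closed_field_poly_normal (char_poly A)).

Lemma eigenvaluesE (C : closedFieldType) (n : nat) (A : 'M[C]_n) :
  char_poly A = \prod_(z <- eigenvalues A) ('X - z%:P).
Proof.
rewrite /eigenvalues; case: closed_field_poly_normal => s /= {1}->.
by rewrite (monicP (char_poly_monic A)) scale1r.
Qed.

Lemma size_eigenvalues (C : closedFieldType) (n : nat) (A : 'M[C]_n) :
  size (eigenvalues A) = n.
Proof.
by have := size_char_poly A; rewrite eigenvaluesE size_prod_XsubC => -[].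
Qed.

(* RD is symmetric, so its eigenvalues are real and normc is the absolute
   value on them. *)
Definition RD_energy (R : rcfType) (G : sgraph) : R :=
  \sum_(z <- eigenvalues (map_mx (real_complex R) (RD R G)))
    ComplexField.Normc.normc z.

Definition Kbip_edge (m n : nat) : rel ('I_m + 'I_n)%type :=
  fun x y => match x, y with
             | inl _, inr _ | inr _, inl _ => true
             | _, _ => false
             end.

Lemma Kbip_edge_sym m n : symmetric (@Kbip_edge m n).
Proof. by move=> [x|x] [y|y]. Qed.

Lemma Kbip_edge_irrefl m n : irreflexive (@Kbip_edge m n).
Proof. by move=> [x|x]. Qed.

Definition Kbip (m n : nat) : sgraph :=
  SGraph (@Kbip_edge_sym m n) (@Kbip_edge_irrefl m n).

Definition del_edge_rel (G : sgraph) (u v : G) : rel G :=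
  fun x y => edge x y && ([set x; y] != [set u; v]).

Lemma del_edge_sym (G : sgraph) (u v : G) : symmetric (del_edge_rel u v).
Proof. by move=> x y; rewrite /del_edge_rel edge_sym setUC. Qed.

Lemma del_edge_irrefl (G : sgraph) (u v : G) : irreflexive (del_edge_rel u v).
Proof. by move=> x; rewrite /del_edge_rel edge_irrefl. Qed.

Definition del_edge (G : sgraph) (u v : G) : sgraph :=
  SGraph (@del_edge_sym G u v) (@del_edge_irrefl G u v).

Lemma Kbip_del_edge_connected (q : nat) (u v : Kbip q q) :
  (2 <= q)%N -> connected_graph (del_edge u v).
Proof.
move=> hq.
have csym : connect_sym (@edge (del_edge u v)).
  exact: sym_connect_sym (@edge_sym _).
have other (i : 'I_q) : exists j : 'I_q, j != i.
  case: q hq i {u v csym} => [|[|q]] // _ i.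
  by case: (eqVneq i ord0) => [->|/negPf ni];
     [exists ord_max | exists ord0; rewrite eq_sym ni].
have LR (i j : 'I_q) : connect (@edge (del_edge u v)) (inl i) (inr j).
  have [i' ni] := other i; have [j' nj] := other j.
  case: (eqVneq [set inl i; inr j : Kbip q q] [set u; v]) => [E|nE]; last first.
    by apply: connect1.
  have step (x y : Kbip q q) : edge x y -> ~~ (x \in [set u; v]) ||
      ~~ (y \in [set u; v]) -> connect (@edge (del_edge u v)) x y.
    move=> xy h; apply: connect1; rewrite /= /del_edge_rel xy /=.
    by apply: contraL h => /eqP <-; rewrite !inE !eqxx ?orbT.
  apply: (@connect_trans _ _ (inr j')).
    by apply: step => //; rewrite -E !inE /= orbC (negPf (_ : inr j' != inr j)).
  apply: (@connect_trans _ _ (inl i')).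
    by apply: step => //; rewrite -E !inE /= (negPf (_ : inr j' != inr j)).
  by apply: step => //; rewrite -E !inE /= (negPf (_ : inl i' != inl i)).
have i0 : 'I_q by exact: Ordinal (ltnW hq).
move=> [x|x] [y|y] //.
- by apply: (connect_trans (LR x i0)); rewrite csym.
- by rewrite csym.
- by apply: connect_trans (LR i0 y); rewrite csym.
Qed.

(* Main.v *)
Require Import Defs.
From mathcomp Require Import all_boot all_order all_algebra.
From mathcomp Require Import complex ring lra zify.
Set Implicit Arguments.
Unset Strict Implicit.
Unset Printing Implicit Defensive.

Import Order.TTheory GRing.Theory Num.Theory.
Local Open Scope ring_scope.

(* Group the vertices into the four cells {u}, rest of its side, {v}, rest of
   its side. Both reciprocal distance matrices are of the form U B U^T - 1/2,
   where U is the incidence matrix of the cells and B is the 4 x 4 matrix of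
   values between cells (the uv entry being d = 1, resp. d = 1/3). Since
   det (t - U V) and det (t - V U) agree up to a power of t, the spectrum is
   -1/2 together with that of a 4 x 4 quotient, which the symmetry exchanging
   the two sides splits into two 2 x 2 blocks. This gives the energy 3q - 1
   for K_{q,q}, and for K_{q,q} - e (when q >= 3) the energy
   q - 2 + (sqrt (81q^2 + 72q - 128) + sqrt (9q^2 + 24q - 32)) / 6. *)

(** * Determinants and characteristic polynomials *)

(** The matrix [M] can be made triangular in two ways: clearing [V] by columns leaves [t - U V],
    while clearing it by rows leaves [t] and [t - V U]. The row operation has determinant [t ^+ k],
    so no division by [t] occurs. *)
Lemma det_scalar_sub_mulmx (A : comNzRingType) (n k : nat) (t : A)
    (U : 'M[A]_(n, k)) (V : 'M[A]_(k, n)) :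
  t ^+ k * \det (t%:M - U *m V) = t ^+ n * \det (t%:M - V *m U).
Proof.
pose M := block_mx t%:M U V 1%:M.
have d1 : \det M = \det (t%:M - U *m V).
  have: M *m block_mx 1%:M 0 (- V) 1%:M = block_mx (t%:M - U *m V) U 0 1%:M.
    by rewrite mulmx_block !mulmx1 !mulmx0 !mul1mx mulmxN subrr !add0r.
  by move/(congr1 determinant); rewrite det_mulmx det_lblock det_ublock !det1 !mulr1.
rewrite -d1 -!det_scalar -(det_ublock _ U).
have <- : block_mx 1%:M 0 (- V) t%:M *m M = block_mx t%:M U 0 (t%:M - V *m U).
  rewrite mulmx_block !mul1mx !mul0mx !addr0 mulmx1 mulNmx mul_mx_scalar.
  by rewrite mul_scalar_mx addNr mulNmx addrC.
by rewrite det_mulmx det_lblock det1 mul1r.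
Qed.

(** Adding the second block row to the first, then subtracting the first block column from the
    second, makes the matrix block lower triangular. *)
Lemma det_symmetric_block (A : comNzRingType) (n : nat) (S T : 'M[A]_n) :
  \det (block_mx S T T S) = \det (S + T) * \det (S - T).
Proof.
rewrite -(det_lblock _ T).
have <- : block_mx 1%:M 1%:M 0 1%:M *m block_mx S T T S *m
          block_mx 1%:M (- 1%:M) 0 1%:M = block_mx (S + T) 0 T (S - T).
  rewrite !mulmx_block !mul1mx !mul0mx !mulmx0 !mulmxN !mulmx1 !addr0 !add0r.
  by congr block_mx; rewrite 1?[T + S]addrC ?addNr // addrC.
by rewrite !det_mulmx !det_ublock !det1 !mul1r mulr1.
Qed.

Lemma char_poly_symmetric_block (A : comNzRingType) (n : nat) (S T : 'M[A]_n) :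
  char_poly (block_mx S T T S) = char_poly (S + T) * char_poly (S - T).
Proof.
rewrite /char_poly /char_poly_mx map_block_mx scalar_mx_block.
rewrite opp_block_mx add_block_mx !sub0r det_symmetric_block.
by rewrite map_mxB map_mxD opprB opprD opprK !addrA [_ + map_mx _ T - _]addrAC.
Qed.

Lemma det_mx22 (A : comNzRingType) (M : 'M[A]_2) :
  \det M = M 0 0 * M 1 1 - M 0 1 * M 1 0.
Proof.
rewrite (expand_det_row _ 0) !big_ord_recl big_ord0 addr0 /cofactor !det_mx11.
rewrite !mxE /= expr0 expr1 mul1r mulN1r mulrN.
by do !congr (_ * _ - _ * _); congr (M _ _); apply: val_inj.
Qed.

Lemma char_poly_mx22 (A : comNzRingType) (M : 'M[A]_2) (r s : A) :
  r + s = M 0 0 + M 1 1 -> r * s = M 0 0 * M 1 1 - M 0 1 * M 1 0 ->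
  char_poly M = ('X - r%:P) * ('X - s%:P).
Proof.
move=> hs hp; rewrite /char_poly det_mx22 !mxE /= !mulr1n !mulr0n.
have: (r + s)%:P = (M 0 0 + M 1 1)%:P by rewrite hs.
have: (r * s)%:P = (M 0 0 * M 1 1 - M 0 1 * M 1 0)%:P by rewrite hp.
rewrite !polyCD !polyCN !polyCM => hp' hs'.
transitivity ('X ^+ 2 - (r%:P + s%:P) * 'X + r%:P * s%:P); last by ring.
rewrite hs' hp'; ring.
Qed.

(** This is [det_scalar_sub_mulmx] over polynomials at [t = 'X + a]. *)
Lemma char_poly_mulmxC_sub (F : comNzRingType) (n k : nat) (a : F)
    (U : 'M[F]_(n, k)) (V : 'M[F]_(k, n)) :
  ('X + a%:P) ^+ k * char_poly (U *m V - a%:M) =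
  ('X + a%:P) ^+ n * char_poly (V *m U - a%:M).
Proof.
have E m (M : 'M[F]_m) :
    char_poly_mx (M - a%:M) = ('X + a%:P)%:M - map_mx polyC M.
  by rewrite /char_poly_mx raddfB /= map_scalar_mx opprB raddfD /= addrA.
by rewrite /char_poly !E !map_mxM det_scalar_sub_mulmx.
Qed.

(** * Energy from a partition into cells *)

Lemma normc_real (R : rcfType) (r : R) :
  ComplexField.Normc.normc (r%:C)%C = `|r|.
Proof. by rewrite /= expr0n addr0 sqrtr_sqr. Qed.

(** The spectrum of [RD] together with [k] copies of -1/2 is the multiset [s] together with [#|G|]
    copies of -1/2; summing absolute values gives the claim. *)
Lemma RD_energy_cells (R : rcfType) (G : sgraph) (k : nat) (f : G -> 'I_k)
    (B : 'M[R]_k) (s : seq R) :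
  (forall x y : G, (if x == y then 0 else (dist x y)%:R^-1) =
     B (f x) (f y) - (x == y)%:R / 2) ->
  char_poly (B *m diag_mx (\row_c #|[pred x | f x == c]|%:R) - (2^-1)%:M) =
    \prod_(r <- s) ('X - r%:P) ->
  RD_energy R G + k%:R / 2 = #|G|%:R / 2 + \sum_(r <- s) `|r|.
Proof.
move=> hB hs.
pose U : 'M[R]_(#|G|, k) := \matrix_(i, c) (f (enum_val i) == c)%:R.
have UBU : RD R G = U *m (B *m U^T) - (2^-1)%:M.
  apply/matrixP=> i j; rewrite mulmxA !mxE -(inj_eq enum_val_inj) hB.
  rewrite (inj_eq enum_val_inj) mulr_natl; congr (_ - _).
  rewrite (bigD1 (f (enum_val j))) //= big1 ?addr0 => [|c nc]; last first.
    by rewrite !mxE eq_sym (negPf nc) mulr0.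
  rewrite !mxE eqxx mulr1 (bigD1 (f (enum_val i))) //= big1 ?addr0 => [|c nc].
    by rewrite !mxE eqxx mul1r.
  by rewrite !mxE eq_sym (negPf nc) mul0r.
have UU : U^T *m U = diag_mx (\row_c #|[pred x | f x == c]|%:R).
  apply/matrixP=> c d; rewrite !mxE.
  under eq_bigr do rewrite !mxE -natrM mulnb.
  rewrite -(big_enum_val (fun x => ((f x == c) && (f x == d))%:R)) /=.
  have [<-|ncd] := eqVneq c d.
    under eq_bigr do rewrite andbb.
    by rewrite -natr_sum -sum1_card [in RHS]big_mkcond.
  rewrite big1 // => x _; case: eqP => // ->; by rewrite (negPf ncd).
have := char_poly_mulmxC_sub 2^-1 U (B *m U^T).
rewrite -UBU -mulmxA UU hs => /(congr1 (map_poly (real_complex R))).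
(* Writing ['X + 1/2] as ['X - h] turns both sides into products of monic linear factors, whose root
   lists agree up to permutation. *)
pose h : R[i] := ((- 2^-1 : R)%:C)%C.
rewrite !rmorphM !rmorphXn rmorphD /= map_polyX map_polyC /= map_char_poly.
rewrite eigenvaluesE.
have -> : 'X + ((2^-1 : R)%:C)%C%:P = 'X - h%:P.
  by rewrite /h [((- _)%:C)%C]rmorphN polyCN opprK.
rewrite rmorph_prod /=.
under [X in _ = _ * X]eq_bigr do rewrite map_polyXsubC.
rewrite -(big_map (real_complex R) predT (fun z => 'X - z%:P)).
have E m : ('X - h%:P) ^+ m = \prod_(z <- nseq m h) ('X - z%:P).
  by rewrite big_nseq iter_mulr_1.
rewrite !E -!big_cat => /prod_XsubC_eq perm.
have sum_perm (t t' : seq R[i]) : perm_eq t t' ->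
    \sum_(z <- t) ComplexField.Normc.normc z =
    \sum_(z <- t') ComplexField.Normc.normc z by move=> tt'; exact: perm_big.
have sum_h m : \sum_(z <- nseq m h) ComplexField.Normc.normc z = m%:R / 2.
  rewrite big_nseq iter_addr_0 normc_real normrN ger0_norm ?invr_ge0 ?ler0n //.
  by rewrite mulr_natl.
have := sum_perm _ _ perm; rewrite !big_cat /= !sum_h big_map addrC => ->.
by congr (_ + _); apply: eq_bigr => r _; exact: normc_real.
Qed.

(** * Walks and distances *)

Lemma has_walk0 (G : sgraph) (x y : G) : has_walk 0 x y = (x == y).
Proof.
apply/existsP/idP => [[p]|xy]; first by rewrite tuple0.
by exists [tuple]; rewrite /= xy.
Qed.

Lemma has_walkS (G : sgraph) (k : nat) (x y : G) :
  has_walk k.+1 x y = [exists z, edge x z && has_walk k z y].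
Proof.
apply/existsP/existsP => [[p]|[z /andP[xz /existsP[p hp]]]].
  case/tupleP: p => z p /=; rewrite -andbA => /andP[xz hp].
  by exists z; rewrite xz; apply/existsP; exists p.
by exists [tuple of z :: p]; rewrite /= xz.
Qed.

Lemma has_walk1 (G : sgraph) (x y : G) : has_walk 1 x y = edge x y.
Proof.
rewrite has_walkS; apply/existsP/idP => [[z]|xy].
  by rewrite has_walk0 => /andP[xz /eqP <-].
by exists y; rewrite has_walk0 eqxx xy.
Qed.

Lemma has_walk_connect (G : sgraph) (k : nat) (x y : G) :
  has_walk k x y -> connect (@edge G) x y.
Proof. by case/existsP=> p /andP[xp /eqP <-]; apply/connectP; exists p. Qed.

Lemma dist_eq (G : sgraph) (k : nat) (x y : G) :
  (k < #|G|)%N -> has_walk k x y ->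
  (forall j, (j < k)%N -> ~~ has_walk j x y) -> dist x y = k.
Proof.
move=> kG w nw; apply/eqP; rewrite eqn_leq dist_min //= leqNgt.
by apply/negP => /nw; rewrite dist_walk // (has_walk_connect w).
Qed.

Definition left_side (m n : nat) (x : Kbip m n) : bool :=
  if x is inl _ then true else false.

Lemma Kbip_edgeE (m n : nat) (x y : Kbip m n) :
  edge x y = (left_side x != left_side y).
Proof. by case: x y => [x|x] [y|y]. Qed.

(** For [b = true] this counts the side opposite [u], for [b = false] the side of [u], with [u]
    included. *)
Lemma card_Kbip_nbrs (q : nat) (u : Kbip q q) (b : bool) :
  #|[pred x | edge u x == b]| = q.
Proof.
rewrite -sum1_card big_sumType /=.
by case: u b => u [] /=; rewrite !sum_nat_const ?card0 !muln1 ?cardT ?size_enum_ord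
  ?addn0 ?add0n //; lia.
Qed.

(** The ends [u] and [v] lie on opposite sides, so exactly one of them is among the [q >= 2]
    neighbours of [x]. *)
Lemma Kbip_nbr_avoid (q : nat) (u v x : Kbip q q) : (2 <= q)%N -> edge u v ->
  exists z, [/\ edge x z, z != u & z != v].
Proof.
move=> hq; rewrite Kbip_edgeE => uv.
have : (0 < #|[predD1 [predD1 [pred z | edge x z == true] & u] & v]|)%N.
  have := card_Kbip_nbrs x true.
  rewrite (cardD1 u) (cardD1 v) !inE !Kbip_edgeE; move: #|_| (v != u) => c b.
  by case: (left_side x) (left_side u) (left_side v) uv b => [] [] [] //= _ []; lia.
by case/card_gt0P=> z; rewrite !inE eqb_id => /and3P[nv nu xz]; exists z.
Qed.

Lemma del_edge_Kbip (q : nat) (u v x y : Kbip q q) : edge u v ->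
  edge (x : del_edge u v) y =
  edge x y && ~~ ((x == u) && (y == v) || (x == v) && (y == u)).
Proof.
move=> uv; transitivity (edge x y && ([set x; y] != [set u; v])) => //.
case: (boolP (edge x y)) => //= xy.
congr (~~ _); apply/eqP/orP => [E|]; last first.
  by case=> /andP[/eqP-> /eqP->] //; rewrite setUC.
have xN : x != y by apply: contraTneq xy => ->; rewrite Kbip_edge_irrefl.
have: x \in [set u; v] by rewrite -E !inE eqxx.
have: y \in [set u; v] by rewrite -E !inE eqxx orbT.
rewrite !inE => /orP[]/eqP ey /orP[]/eqP ex; move: xN; rewrite ex ey !eqxx //.
  by right.
by left.
Qed.

Lemma dist_Kbip (q : nat) (x y : Kbip q q) : (2 <= q)%N ->
  dist x y = if x == y then 0%N else if edge x y then 1%N else 2%N.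
Proof.
move=> hq; have c3 : (3 < #|Kbip q q|)%N by rewrite card_sum !card_ord; lia.
have [<-|nxy] := eqVneq x y.
  by apply: dist_eq; rewrite ?has_walk0 //; lia.
case: ifPn => xy.
  apply: dist_eq; rewrite ?has_walk1 //; first lia.
  by case=> // _; rewrite has_walk0.
apply: dist_eq; first lia.
  have [z xz] : exists z, edge x z.
    by have /card_gt0P[z] : (0 < #|[pred z | edge x z == true]|)%N;
      [rewrite card_Kbip_nbrs; lia | rewrite inE eqb_id; exists z].
  rewrite has_walkS; apply/existsP; exists z; rewrite xz has_walk1.
  by move: xz xy; rewrite !Kbip_edgeE; do 3 case: left_side.
by case=> [|[|]] // _; rewrite ?has_walk0 ?has_walk1.
Qed.

Lemma dist_del_edge (q : nat) (u v x y : Kbip q q) : (2 <= q)%N -> edge u v ->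
  dist (x : del_edge u v) y =
  if x == y then 0%N else if ~~ edge x y then 2%N else
  if (x == u) && (y == v) || (x == v) && (y == u) then 3%N else 1%N.
Proof.
(* [dist] minimises over lengths below the number of vertices, here [2 q >= 4], which leaves room
   for the distance 3. *)
move=> hq uv; have c3 : (3 < #|del_edge u v|)%N by rewrite card_sum !card_ord; lia.
have [<-|nxy] := eqVneq x y.
  by apply: dist_eq; rewrite ?has_walk0 //; lia.
case: ifPn => xy.
  apply: dist_eq; first lia.
    have [z [xz /negPf zu /negPf zv]] := Kbip_nbr_avoid x hq uv.
    rewrite has_walkS; apply/existsP; exists z.
    rewrite has_walk1 !del_edge_Kbip // zu zv !andbF !andFb xz andbT.
    by move: xz xy; rewrite !Kbip_edgeE; do 3 case: left_side.
  by case=> [|[|]] // _; rewrite ?has_walk0 ?has_walk1 // del_edge_Kbip // (negPf xy).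
rewrite negbK in xy.
case: ifPn => xyuv; last first.
  apply: dist_eq; rewrite ?has_walk1 ?del_edge_Kbip ?xy //; first lia.
  by case=> // _; rewrite has_walk0.
apply: dist_eq; first lia.
  (* The detour [x], [z], [w], [y] has inner vertices other than [u] and [v], so all its edges
     survive. *)
  have [z [xz /negPf zu /negPf zv]] := Kbip_nbr_avoid x hq uv.
  have [w [yw /negPf wu /negPf wv]] := Kbip_nbr_avoid y hq uv.
  have xz' : edge (x : del_edge u v) z.
    by rewrite del_edge_Kbip // zu zv !andbF xz.
  have wy' : edge (w : del_edge u v) y.
    by rewrite edge_sym del_edge_Kbip // wu wv !andbF yw.
  rewrite has_walkS; apply/existsP; exists z; rewrite xz' has_walkS.
  apply/existsP; exists w; rewrite has_walk1 wy' andbT del_edge_Kbip // zu zv.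
  rewrite !andFb andbT.
  by move: xz yw xy; rewrite !Kbip_edgeE; do 4 case: left_side.
case=> [|[|[|]]] // _; rewrite ?has_walk0 ?has_walk1 ?del_edge_Kbip // ?xy ?xyuv //.
(* Length 2 is excluded by parity: two edges lead back to the side of [x]. *)
rewrite has_walkS; apply/existsP=> -[z]; rewrite has_walk1 !del_edge_Kbip //.
by case/andP=> /andP[+ _] /andP[+ _]; move: xy; rewrite !Kbip_edgeE; do 3 case: left_side.
Qed.

(** * The quotient on four cells *)

Definition cell_idx (b : bool) : 'I_2 := if b then 1 else 0.

(* The cells are, in this order: u, the other vertices on its side, v, the
   other vertices on its side. *)
Definition cell (q : nat) (u v : Kbip q q) (x : Kbip q q) : 'I_(2 + 2) :=
  if edge u x then rshift 2 (cell_idx (x != v)) else lshift 2 (cell_idx (x != u)).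

(** The value 1/2 is also used for a vertex and itself; the shift by -1/2 then restores the zero
    diagonal of [RD]. *)
Definition same_side (R : rcfType) : 'M[R]_2 := const_mx 2^-1.

Definition cross_side (R : rcfType) (d : R) : 'M[R]_2 :=
  \matrix_(i, j) if (i == 0) && (j == 0) then d else 1.

Definition cell_mx (R : rcfType) (d : R) : 'M[R]_(2 + 2) :=
  block_mx (same_side R) (cross_side d) (cross_side d) (same_side R).

Lemma cell_idx_eq0 (b : bool) : (cell_idx b == 0) = ~~ b.
Proof. by case: b. Qed.

Lemma cell_mxE (R : rcfType) (d : R) (q : nat) (u v x y : Kbip q q) :
  edge u v ->
  cell_mx d (cell u v x) (cell u v y) =
  if ~~ edge x y then 2^-1 else
  if (x == u) && (y == v) || (x == v) && (y == u) then d else 1.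
Proof.
move=> uv; have nu z : edge u z -> (z == u) = false.
  by move=> uz; apply: contraTF uz => /eqP->; rewrite edge_irrefl.
have nv z : ~~ edge u z -> (z == v) = false.
  by move=> uz; apply: contraNF uz => /eqP->.
have exy : edge x y = (edge u x != edge u y).
  by rewrite !Kbip_edgeE; do 3 case: left_side.
rewrite /cell_mx /cell exy.
case: (boolP (edge u x)) => ux; case: (boolP (edge u y)) => uy;
  rewrite ?block_mxEul ?block_mxEur ?block_mxEdl ?block_mxEdr !mxE //=;
  rewrite !cell_idx_eq0 !negbK.
  by rewrite (nu x) ?(nv y) //= ?andbF ?orbF.
by rewrite (nv x) // orbF.
Qed.

Lemma card_cell (R : rcfType) (q : nat) (u v : Kbip q q) : edge u v ->
  \row_c #|[pred x | cell u v x == c]|%:R =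
  row_mx (\row_j (if j == 0 then 1 else q%:R - 1))
         (\row_j (if j == 0 then 1 else q%:R - 1)) :> 'rV[R]_(2 + 2).
Proof.
move=> uv.
have cards (w : Kbip q q) b : edge u w = b ->
    #|[pred x | (edge u x == b) && (x != w)]|%:R = q%:R - 1 :> R.
  move=> uw; have := card_Kbip_nbrs u b; rewrite (cardD1 w) inE uw eqxx.
  move=> /(congr1 (fun n => n%:R : R)) <-; rewrite natrD addrC addKr.
  by congr (_%:R); apply: eq_card => x; rewrite !inE andbC.
have card1s (w : Kbip q q) b : edge u w = b ->
    #|[pred x | (edge u x == b) && (x == w)]|%:R = 1 :> R.
  move=> uw; rewrite -[RHS](_ : 1%:R = 1) // -(card1 w).
  congr (_%:R); apply: eq_card => x; rewrite !inE.
  by case: (eqVneq x w) => [->|]; rewrite ?uw ?eqxx ?andbF.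
have uu : edge u u = false by rewrite edge_irrefl.
apply/rowP=> c; rewrite mxE -(splitK c); case: split => j /=;
  rewrite ?row_mxEl ?row_mxEr mxE; case: ifPn => j0.
- rewrite -[RHS](card1s u false) //; congr (_%:R); apply: eq_card => x.
  rewrite !inE /cell (eqP j0); case: ifP => _; first by rewrite eq_rlshift.
  by rewrite (inj_eq (@lshift_inj _ _)) cell_idx_eq0 negbK.
- have -> : j = 1 by case: j j0 => [[|[|]]] //= i _; apply: val_inj.
  rewrite -[RHS](cards u false) //; congr (_%:R); apply: eq_card => x.
  rewrite !inE /cell; case: ifP => _; first by rewrite eq_rlshift.
  by rewrite (inj_eq (@lshift_inj _ _)); case: (x == u).
- rewrite -[RHS](card1s v true) //; congr (_%:R); apply: eq_card => x.
  rewrite !inE /cell (eqP j0); case: ifP => _; last by rewrite eq_lrshift.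
  by rewrite (inj_eq (@rshift_inj _ _)) cell_idx_eq0 negbK.
- have -> : j = 1 by case: j j0 => [[|[|]]] //= i _; apply: val_inj.
  rewrite -[RHS](cards v true) //; congr (_%:R); apply: eq_card => x.
  rewrite !inE /cell; case: ifP => _; last by rewrite eq_lrshift.
  by rewrite (inj_eq (@rshift_inj _ _)); case: (x == v).
Qed.

(** The hypotheses are the traces and determinants of two 2 x 2 blocks: [r1], [r2] belong to the
    part symmetric under exchange of the sides, [r3], [r4] to the antisymmetric part. *)
Lemma char_poly_cell_mx (R : rcfType) (d : R) (q : nat) (u v : Kbip q q)
    (r1 r2 r3 r4 : R) :
  edge u v ->
  r1 + r2 = d + (3 * q%:R - 4) / 2 ->
  r1 * r2 = d * (3 * q%:R - 4) / 2 - 9 * (q%:R - 1) / 4 ->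
  r3 + r4 = - d - q%:R / 2 ->
  r3 * r4 = d * q%:R / 2 - (q%:R - 1) / 4 ->
  char_poly (cell_mx d *m diag_mx (\row_c #|[pred x | cell u v x == c]|%:R)
             - (2^-1)%:M) =
  \prod_(r <- [:: r1; r2; r3; r4]) ('X - r%:P).
Proof.
move=> uv h1 h2 h3 h4; rewrite card_cell // diag_mx_row /cell_mx mulmx_block.
rewrite !mulmx0 !addr0 !add0r scalar_mx_block opp_block_mx add_block_mx !oppr0 !addr0.
rewrite char_poly_symmetric_block.
rewrite (@char_poly_mx22 _ _ r1 r2) ?(@char_poly_mx22 _ _ r3 r4).
- by rewrite !big_cons big_nil mulr1 !mulrA.
all: by rewrite !mul_mx_diag !mxE /= ?mulr1n ?mulr0n ?h1 ?h2 ?h3 ?h4; field.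
Qed.

(** * The two energies and their comparison *)

(** The relation [e] is left open so that both graphs are covered, with [d = 1] and [d = 1/3]. *)
Lemma RD_energy_roots (R : rcfType) (q : nat) (u v : Kbip q q)
    (e : rel (Kbip q q)) (e_sym : symmetric e) (e_irr : irreflexive e)
    (d r1 r2 r3 r4 : R) :
  edge u v ->
  (forall x y : SGraph e_sym e_irr, x != y -> (dist x y)%:R^-1 =
    if ~~ edge (x : Kbip q q) y then 2^-1 else
    if (x == u) && (y == v) || (x == v) && (y == u) then d else 1) ->
  r1 + r2 = d + (3 * q%:R - 4) / 2 ->
  r1 * r2 = d * (3 * q%:R - 4) / 2 - 9 * (q%:R - 1) / 4 ->
  r3 + r4 = - d - q%:R / 2 ->
  r3 * r4 = d * q%:R / 2 - (q%:R - 1) / 4 ->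
  RD_energy R (SGraph e_sym e_irr) = q%:R - 2 + (`|r1| + `|r2| + (`|r3| + `|r4|)).
Proof.
move=> uv hd h1 h2 h3 h4.
have := @RD_energy_cells R (SGraph e_sym e_irr) (2 + 2) (cell u v) (cell_mx d)
  [:: r1; r2; r3; r4] _ (char_poly_cell_mx uv h1 h2 h3 h4).
have -> : #|SGraph e_sym e_irr| = (q + q)%N by rewrite card_sum !card_ord.
rewrite !big_cons big_nil addr0 (natrD _ q q) => energyE.
apply: (addIr ((2 + 2)%N%:R / 2)).
rewrite {}energyE => [|x y]; first by field.
rewrite cell_mxE //; case: (eqVneq x y) => [<-|xy].
  by rewrite (edge_irrefl (x : Kbip q q)) mul1r subrr.
by rewrite mul0r subr0 hd.
Qed.

Lemma RD_energy_Kbip (R : rcfType) (q : nat) (u v : Kbip q q) :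
  (2 <= q)%N -> edge u v -> RD_energy R (Kbip q q) = 3 * q%:R - 1.
Proof.
move=> hq uv; have Q2 : 2 <= q%:R :> R by rewrite ler_nat.
(* At [d = 1] the discriminants are the squares [9 q^2 / 4] and [q^2 / 4], so the roots are rational
   in [q]. *)
rewrite (@RD_energy_roots R q u v (@Kbip_edge q q) _ _ 1
  ((3 * q%:R - 1) / 2) (- 2^-1) (- 2^-1) (- ((q%:R + 1) / 2))) //.
- rewrite !normrN !ger0_norm; lra.
- move=> x y /negPf xy; rewrite dist_Kbip // xy if_same.
  by case: ifP; rewrite ?invr1.
all: by field.
Qed.

(* With d = 1/3 the two pairs of roots have discriminants [s ^+ 2 / 36] and
   [t ^+ 2 / 36]. *)
Lemma RD_energy_del_edge (R : rcfType) (q : nat) (u v : Kbip q q) :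
  (2 <= q)%N -> edge u v ->
  let s := Num.sqrt (81 * q%:R ^+ 2 + 72 * q%:R - 128 : R) in
  let t := Num.sqrt (9 * q%:R ^+ 2 + 24 * q%:R - 32 : R) in
  RD_energy R (del_edge u v) = q%:R - 2 +
    (`|(9 * q%:R - 10 + s) / 12| + `|(9 * q%:R - 10 - s) / 12| +
     (`|(- (3 * q%:R + 2) + t) / 12| + `|(- (3 * q%:R + 2) - t) / 12|)).
Proof.
move=> hq uv s t; have Q2 : 2 <= q%:R :> R by rewrite ler_nat.
have s2 : s ^+ 2 = 81 * q%:R ^+ 2 + 72 * q%:R - 128 by rewrite sqr_sqrtr //; nra.
have t2 : t ^+ 2 = 9 * q%:R ^+ 2 + 24 * q%:R - 32 by rewrite sqr_sqrtr //; nra.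
apply: (@RD_energy_roots R q u v (del_edge_rel u v) _ _ 3^-1) => //.
- move=> x y /negPf xy; rewrite dist_del_edge // xy.
  by case: ifP => // _; case: ifP; rewrite ?invr1.
- by field.
- transitivity (((9 * q%:R - 10) ^+ 2 - s ^+ 2) / 144); first by field.
  by rewrite s2; field.
- by field.
- transitivity (((3 * q%:R + 2) ^+ 2 - t ^+ 2) / 144); first by field.
  by rewrite t2; field.
Qed.

Theorem theorem10 (R : rcfType) (q : nat) (hq : (2 <= q)%N)
    (u v : Kbip q q) (huv : edge u v) :
  ((q <= 7)%N -> RD_energy R (del_edge u v) < RD_energy R (Kbip q q)) /\
  ((8 <= q)%N -> RD_energy R (Kbip q q) < RD_energy R (del_edge u v)).
Proof.
rewrite (RD_energy_Kbip R hq huv) (RD_energy_del_edge R hq huv).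
set s := Num.sqrt (81 * _ + _ - _); set t := Num.sqrt (9 * _ + _ - _).
have Q2 : 2 <= q%:R :> R by rewrite ler_nat.
have s2 : s ^+ 2 = 81 * q%:R ^+ 2 + 72 * q%:R - 128 by rewrite sqr_sqrtr //; nra.
have t2 : t ^+ 2 = 9 * q%:R ^+ 2 + 24 * q%:R - 32 by rewrite sqr_sqrtr //; nra.
have s0 : 0 <= s by exact: sqrtr_ge0.
have t0 : 0 <= t by exact: sqrtr_ge0.
(* The heart of the matter is [s + t] against [12 Q + 6 = (9 Q + 3) + (3 Q + 3)]. Here
   [s^2 - (9 Q + 3)^2 = 18 Q - 137] and [t^2 - (3 Q + 3)^2 = 6 Q - 41], both positive once
   [Q >= 8]. *)
set Q := q%:R in Q2 s2 t2 *; split=> hq'.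
  have Q7 : Q <= 7 by rewrite ler_nat.
  have s_lb : 9 * Q - 10 <= s by nra.
  (* The slack 1/24 is needed only at q = 7, where t exceeds 3 q + 3. *)
  have s_ub : s < 9 * Q + 3 - 24^-1 by nra.
  have t_ub : t < 3 * Q + 3 + 24^-1 by nra.
  have -> : `|(9 * Q - 10 + s) / 12| = (9 * Q - 10 + s) / 12.
    by apply: ger0_norm; lra.
  have -> : `|(9 * Q - 10 - s) / 12| = - ((9 * Q - 10 - s) / 12).
    by apply: ler0_norm; lra.
  have -> : `|(- (3 * Q + 2) - t) / 12| = - ((- (3 * Q + 2) - t) / 12).
    by apply: ler0_norm; lra.
  (* Since [t^2 - (3 Q + 2)^2 = 12 Q - 36], this root is negative only at [q = 2]; [3 Q + 2] then
     takes the place of [t]. *)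
  by case: (ger0P ((- (3 * Q + 2) + t) / 12)) => _; lra.
have Q8 : 8 <= Q by rewrite ler_nat.
have s_lb : 9 * Q + 3 < s by nra.
have t_lb : 3 * Q + 3 < t by nra.
(* Bounding each absolute value below by a signed copy of its argument gives a total of
   [(s + t) / 6], with no discussion of signs. *)
have := ler_norm ((9 * Q - 10 + s) / 12).
have := ler_norm (- ((9 * Q - 10 - s) / 12)); rewrite normrN.
have := ler_norm ((- (3 * Q + 2) + t) / 12).
have := ler_norm (- ((- (3 * Q + 2) - t) / 12)); rewrite normrN.
lra.
Qed.
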